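(* Let $s,n\ge0$ be integers and $w\in\{\mathtt a,\mathtt b\}^n$. Then the cardinality of the $\approx_s$-class $[w]_s\subseteq\{\mathtt a,\mathtt b\}^n$ of $w$ is the coefficient $$\#[w]_s=[q^{\,R_s(w)}]\binom{(|w|_{\mathtt a}-\ell)+(|w|_{\mathtt b}-\theta)}{|w|_{\mathtt a}-\ell}_{\!q}.$$
   Context: For words $w,v$, $\binom{w}{v}$ is the number of occurrences of $v$ as a scattered subword of $w$; $|w|_{x}$ is the number of letters $x$ in $w$. For $u,w\in\{\mathtt a,\mathtt b\}^n$: $u\sim_2w$ iff $|u|_{\mathtt a}=|w|_{\mathtt a}$ and $\binom{u}{\mathtt{ab}}=\binom{w}{\mathtt{ab}}$. For $w\in\{\mathtt a,\mathtt b\}^n$ let $\lambda(w)=(r_1,\dots,r_{|w|_{\mathtt a}})$ where $r_i$ is the number of $\mathtt b$'s to the right of the $i$-th $\mathtt a$. Let $\ell=\min(s,|w|_{\mathtt a})$; the $s$-tail is $\mathcal T_s(w)=(r_{|w|_{\mathtt a}},\dots,r_{|w|_{\mathtt a}-\ell+1})$ (empty if $\ell=0$). Let $\theta=r_{|w|_{\mathtt a}-\ell+1}$ be its last entry and $|\mathcal T_s(w)|$ the sum of its entries, both $0$ when $\ell=0$. Define $u\approx_sw$ iff $u\sim_2w$ and $\mathcal T_s(u)=\mathcal T_s(w)$. The $s$-residual area is $$R_s(w)=\binom{w}{\mathtt{ab}}-(|w|_{\mathtt a}-\ell)\,\theta-|\mathcal T_s(w)|.$$ The Gaussian binomial coefficient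 is the polynomial $\binom{c}{d}_q=\prod_{i=1}^d\frac{1-q^{c-d+i}}{1-q^i}$ for $0\le d\le c$ (and $0$ otherwise); $[q^k]f$ denotes the coefficient of $q^k$ in $f$. *)

(* Defs.v *)
From HB Require Import structures.
From mathcomp Require Import all_boot all_order all_algebra.
From mathcomp Require Import ring.

Set Implicit Arguments.
Unset Strict Implicit.
Unset Printing Implicit Defensive.

Import Order.TTheory GRing.Theory Num.Theory.

Local Open Scope ring_scope.

(* The binary alphabet {a, b} is encoded by the booleans. *)
Definition la : bool := true.
Definition lb : bool := false.

(* An occurrence of v in w as a scattered subword is a set of positions of w,  *)
(* given by its characteristic mask, at which the letters of w spell out v.    *)
Definition scattered (w v : seq bool) : nat :=
  #|[set m : (size w).-tuple bool | mask m w == v]|.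

Definition sim2 (n : nat) (u w : n.-tuple bool) : bool :=
  (count_mem la u == count_mem la w)
  && (scattered u [:: la; lb] == scattered w [:: la; lb]).

Definition lambda (w : seq bool) : seq nat :=
  [seq count_mem lb (drop i.+1 w) | i <- iota 0 (size w) & nth lb w i == la].

Definition ell (s : nat) (w : seq bool) : nat := minn s (count_mem la w).

Definition tail (s : nat) (w : seq bool) : seq nat :=
  take (ell s w) (rev (lambda w)).

Definition theta (s : nat) (w : seq bool) : nat := last 0%N (tail s w).

Definition approx (s n : nat) (u w : n.-tuple bool) : bool :=
  sim2 u w && (tail s u == tail s w).

Definition approx_class (s n : nat) (w : n.-tuple bool) : {set n.-tuple bool} :=
  [set u | approx s u w].

(* Integer valued, so that the subtractions are not truncated; the remaining   *)
(* natural-number subtraction is harmless since ell s w <= |w|_a.              *)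
Definition residual_area (s : nat) (w : seq bool) : int :=
  (scattered w [:: la; lb])%:Z
  - ((count_mem la w - ell s w) * theta s w)%N%:Z
  - (sumn (tail s w))%:Z.

Definition gauss_num (c d : nat) : {poly rat} :=
  \prod_(1 <= i < d.+1) (1 - 'X^(c - d + i)).

Definition gauss_den (d : nat) : {poly rat} :=
  \prod_(1 <= i < d.+1) (1 - 'X^i).

(* The Euclidean quotient is exact and unique: gauss_binomE, gauss_den_neq0.   *)
Definition gauss_binom (c d : nat) : {poly rat} :=
  if (d <= c)%N then gauss_num c d %/ gauss_den d else 0.

Definition coefz (p : {poly rat}) (k : int) : rat :=
  if k is Posz m then p`_m else 0.

Lemma gauss_numS c d :
  (d <= c)%N -> gauss_num c.+1 d.+1 = gauss_num c d * (1 - 'X^(c.+1)).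
Proof.
move=> le_dc; rewrite /gauss_num big_nat_recr //= subSS.
by rewrite addnS subnK.
Qed.

Lemma gauss_numSr c d :
  (d < c)%N -> gauss_num c d.+1 = (1 - 'X^(c - d)) * gauss_num c d.
Proof.
move=> lt_dc; rewrite /gauss_num big_nat_recl //= addn1 subnSK //.
congr (_ * _); apply: eq_big_nat => i _.
by rewrite addnS -addSn subnSK.
Qed.

Lemma gauss_den_dvd c d : (d <= c)%N -> gauss_den d %| gauss_num c d.
Proof.
elim: c d => [|c IHc] [|d] le_dc //; try by rewrite /gauss_den big_geq ?dvd1p.
rewrite /gauss_den big_nat_recr //= -/(gauss_den d) gauss_numS //.
have -> : gauss_num c d * (1 - 'X^(c.+1)) = gauss_num c d * (1 - 'X^(d.+1))
            + 'X^(d.+1) * ((1 - 'X^(c - d)) * gauss_num c d).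
  have -> : c.+1 = (d.+1 + (c - d))%N by rewrite addSn subnKC.
  rewrite exprD; ring.
apply: dvdp_add; first by rewrite dvdp_mul // IHc.
apply: dvdp_mull; move: le_dc; rewrite ltnS leq_eqVlt => /predU1P[->|lt_dc].
  by rewrite subnn expr0 subrr mul0r dvdp0.
by rewrite -gauss_numSr //; have := IHc _ lt_dc; rewrite {1}/gauss_den big_nat_recr.
Qed.

Lemma gauss_den_neq0 d : gauss_den d != 0.
Proof.
rewrite /gauss_den big_add1 big_mkord prodf_seq_neq0; apply/allP => i _ /=.
apply/eqP => /(congr1 (fun p : {poly rat} => p`_0)) /eqP.
by rewrite coefB coef1 coefXn coef0 subr0 oner_eq0.
Qed.

Lemma gauss_binomE c d :
  (d <= c)%N -> gauss_binom c d * gauss_den d = gauss_num c d.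
Proof. by move=> le_dc; rewrite /gauss_binom le_dc divpK // gauss_den_dvd. Qed.

(* Hence |w|_b - theta s w is not truncated either.                            *)
Lemma theta_le s w : (theta s w <= count_mem lb w)%N.
Proof.
have le_tail : all (fun r => r <= count_mem lb w)%N (tail s w).
  apply/allP => r /mem_take; rewrite mem_rev => /mapP[i _ ->].
  by rewrite -[in leqRHS](cat_take_drop i.+1 w) count_cat leq_addl.
rewrite /theta; case: (tail s w) le_tail => // r t le_rt.
exact: (allP le_rt _ (mem_last r t)).
Qed.

(* Main.v *)
Require Import Defs.
From HB Require Import structures.
From mathcomp Require Import all_boot all_order all_algebra.
From mathcomp Require Import ring zify.

(* Cut w = y ++ x where x starts at the (ell s w)-th a from the right (x is    *)
(* empty when ell s w = 0). The tail of w is lambda x reversed, theta is the   *)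
(* number of b's of x, and lambda determines such an x; hence the class of w   *)
(* consists of the words y' ++ x where y' has as many a's, b's and scattered   *)
(* occurrences of ab as y, and the latter number is the residual area. Words   *)
(* with prescribed numbers of letters and of occurrences of ab are counted by  *)
(* removing the first letter, which gives the q-Pascal recurrence.             *)

Set Implicit Arguments.
Unset Strict Implicit.
Unset Printing Implicit Defensive.

Import Order.TTheory GRing.Theory Num.Theory.

Local Open Scope ring_scope.

(** By [scattered_ab] the number of occurrences of ab is the sum of [lambda], a partition in a box
    with [count_mem la] rows of length at most [count_mem lb]. Fixing the tail fixes the suffix [x]
    ([tail_catP]), and removing [x] leaves the partition of the prefix [y], whose size is the
    residual area ([residual_area_cat]). The Gaussian binomial is the generating function by size of
    the partitions in the box of [y] ([card_words]). *)

Lemma count_la_lb (w : seq bool) : (count_mem la w + count_mem lb w)%N = size w.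
Proof.
rewrite -(count_predC (pred1 la) w); congr (_ + _)%N.
by apply: eq_count => -[].
Qed.

Lemma lambda_cons x w :
  lambda (x :: w) = if x then count_mem lb w :: lambda w else lambda w.
Proof.
rewrite /lambda /= (iotaDl 1 0).
by case: x; rewrite /= filter_map -map_comp ?drop0.
Qed.

Lemma size_lambda w : size (lambda w) = count_mem la w.
Proof. by elim: w => // -[] w IHw; rewrite lambda_cons /= IHw. Qed.

Lemma lambda_cat y x :
  lambda (y ++ x) = [seq (r + count_mem lb x)%N | r <- lambda y] ++ lambda x.
Proof.
by elim: y => // -[] y IHy; rewrite cat_cons !lambda_cons //= IHy count_cat.
Qed.

Lemma sumn_lambda_cat y x :
  sumn (lambda (y ++ x))
  = (sumn (lambda y) + count_mem la y * count_mem lb x + sumn (lambda x))%N.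
Proof.
rewrite lambda_cat sumn_cat -size_lambda; congr (_ + _)%N.
by elim: (lambda y) => //= r t ->; lia.
Qed.

Lemma lambda_le w : all (fun r => r <= count_mem lb w)%N (lambda w).
Proof.
elim: w => // -[] w IHw; rewrite lambda_cons /= ?leqnn //.
by apply: sub_all IHw => r; exact: leqW.
Qed.

(** The first letter can be read off: a word starting with a has its total number of b's as first
    entry, while after a leading b every entry is smaller than that total. *)
Lemma lambda_inj u v :
  count_mem lb u = count_mem lb v -> lambda u = lambda v -> u = v.
Proof.
elim: u v => [|x u IHu] [|y v] //=; rewrite ?lambda_cons.
- by case: y.
- by case: x.
have hd_le a b t : count_mem lb a = (1 + count_mem lb b)%N ->
    count_mem lb a :: t = lambda b -> False.
  by move=> ab ab'; have := lambda_le b; rewrite -ab' ab => /andP[]; lia.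
case: x y => [] [] /=.
- by move=> _ [/IHu/[apply] ->].
- by move=> /hd_le/[apply].
- by move=> /esym/hd_le H /esym/H.
- by move=> [/IHu]/[apply] ->.
Qed.

(** * Counting tuples by first letter or by suffix *)

Lemma card_tupleS n (P : pred (seq bool)) :
  #|[set t : n.+1.-tuple bool | P t]|
  = (#|[set t : n.-tuple bool | P (true :: t)]|
     + #|[set t : n.-tuple bool | P (false :: t)]|)%N.
Proof.
have im b : #|[set t : n.-tuple bool | P (b :: t)]|
    = #|[set t : n.+1.-tuple bool | P t & thead t == b]|.
  rewrite -(card_imset _ (f := fun t : n.-tuple bool => [tuple of b :: t])).
    apply: eq_card => t; rewrite inE; apply/imsetP/andP => [[u + ->]|[Pt tb]].
      by rewrite inE theadE eqxx.
    exists [tuple of behead t]; last first.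
      by rewrite {1}[t]tuple_eta; apply: val_inj; rewrite /= (eqP tb).
    by rewrite inE /=; move: Pt; rewrite {1}[t]tuple_eta (eqP tb).
  by move=> t u /(congr1 val) /= [tu]; apply: val_inj.
(* The two images are disjoint, since their heads differ. *)
rewrite !im -cardsUI [X in (_ + X)%N]eq_card0 ?addn0.
  by apply: eq_card => t; rewrite !inE; case: (thead t); rewrite ?andbT ?andbF ?orbF.
by move=> t; rewrite !inE; case: (thead t); rewrite ?andbF.
Qed.

Lemma card_tuple_suffix n m (x : seq bool) (P : pred (seq bool)) :
  n = (m + size x)%N ->
  #|[set t : n.-tuple bool | (drop m t == x) && P (take m t)]|
  = #|[set t : m.-tuple bool | P t]|.
Proof.
move=> ->.
rewrite -(card_imset _ (f := fun t : m.-tuple bool => cat_tuple t (in_tuple x))).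
  apply: eq_card => t; rewrite inE; apply/andP/imsetP => [[/eqP tx Pt]|[u + ->]].
    have sz : size (take m t) == m by rewrite size_takel // size_tuple leq_addr.
    exists (Tuple sz); rewrite ?inE //.
    by apply: val_inj; rewrite /= -[in LHS](cat_take_drop m t) tx.
  by rewrite inE /= drop_size_cat ?take_size_cat ?size_tuple.
by move=> t u /(congr1 val) /eqP; rewrite eqseq_cat ?size_tuple // => /andP[/eqP/val_inj].
Qed.

Lemma card_tuple0 (P : pred (seq bool)) :
  #|[set t : 0.-tuple bool | P t]| = P [::].
Proof.
case: (boolP (P [::])) => P0; last first.
  by rewrite eq_card0 // => t; rewrite inE tuple0 (negPf P0).
apply: etrans (cards1 ([tuple] : 0.-tuple bool)); apply: eq_card => t.
by rewrite !inE tuple0 P0 eqxx.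
Qed.

(** * Recurrences for scattered subwords *)

Lemma scattered_nil w : scattered w [::] = 1%N.
Proof.
rewrite /scattered; elim: w => [|x w IHw]; first by rewrite (card_tuple0 (fun m => mask m [::] == [::])).
rewrite (card_tupleS _ (fun m => mask m (x :: w) == [::])) /= IHw.
by rewrite eq_card0 // => t; rewrite inE.
Qed.

Lemma scattered_cons x w y v :
  scattered (x :: w) (y :: v)
  = ((if x == y then scattered w v else 0) + scattered w (y :: v))%N.
Proof.
rewrite /scattered (card_tupleS _ (fun m => mask m (x :: w) == y :: v)) /=.
congr (_ + _)%N; case: eqP => [->|/eqP/negPf xy].
  by apply: eq_card => t; rewrite !inE eqseq_cons eqxx.
by rewrite eq_card0 // => t; rewrite inE eqseq_cons xy.
Qed.

Lemma scattered0 y v : scattered [::] (y :: v) = 0%N.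
Proof. by rewrite /scattered (card_tuple0 (fun m => mask m [::] == y :: v)). Qed.

Lemma scattered1 w y : scattered w [:: y] = count_mem y w.
Proof.
elim: w => [|x w IHw]; first by rewrite scattered0.
by rewrite scattered_cons scattered_nil IHw /=; case: eqP.
Qed.

Lemma scattered_ab w : scattered w [:: la; lb] = sumn (lambda w).
Proof.
elim: w => [|x w IHw]; first by rewrite scattered0.
by rewrite scattered_cons lambda_cons scattered1 IHw; case: x.
Qed.

(** * Gaussian binomials as generating functions *)

Lemma gauss_binom0 c : gauss_binom c 0 = 1.
Proof.
have := gauss_binomE (leq0n c).
by rewrite /gauss_den /gauss_num !big_geq // mulr1.
Qed.

Lemma gauss_binom_small c d : (c < d)%N -> gauss_binom c d = 0.
Proof. by rewrite /gauss_binom ltnNge => /negPf ->. Qed.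

(** After clearing the denominator this is [1 - q^(c+1) = q^(c-d) (1 - q^(d+1)) + (1 - q^(c-d))]. *)
Lemma gauss_binomS c d :
  gauss_binom c.+1 d.+1 = gauss_binom c d * 'X^(c - d) + gauss_binom c d.+1.
Proof.
have [lt_cd|le_dc] := ltnP c d.
  by rewrite !gauss_binom_small ?mul0r ?addr0 //; apply: ltnW.
apply: (mulIf (gauss_den_neq0 d.+1)).
have denS : gauss_den d.+1 = gauss_den d * (1 - 'X^(d.+1)).
  by rewrite /gauss_den big_nat_recr.
have last_term : gauss_binom c d.+1 * gauss_den d.+1
    = (1 - 'X^(c - d)) * gauss_num c d.
  have [lt_dc|le_cd] := ltnP d c; first by rewrite gauss_binomE // gauss_numSr.
  (* For [c = d] both sides vanish, the right one through the factor [1 - 'X^0]. *)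
  have /eqP -> : (c - d == 0)%N by rewrite subn_eq0.
  by rewrite gauss_binom_small // mul0r expr0 subrr mul0r.
rewrite mulrDl last_term gauss_binomE // gauss_numS // denS -gauss_binomE //.
have -> : c.+1 = (d.+1 + (c - d))%N by rewrite addSn subnKC.
rewrite exprD; ring.
Qed.

Lemma card_words c d k :
  #|[set t : c.-tuple bool | (count_mem la t == d) && (sumn (lambda t) == k)]|%:R
  = (gauss_binom c d)`_k.
Proof.
pose P d k (t : seq bool) := (count_mem la t == d) && (sumn (lambda t) == k).
rewrite -[[set _ | _]]/[set t : c.-tuple bool | P d k t].
elim: c d k => [|c IHc] [|d] k.
- by rewrite card_tuple0 gauss_binom0 coef1 /P /= eq_sym.
- by rewrite card_tuple0 gauss_binom_small // coef0.
- rewrite card_tupleS eq_card0 => [|t]; last by rewrite inE.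
  rewrite gauss_binom0 -(gauss_binom0 c) -IHc; congr (_%:R).
  by apply: eq_card => t; rewrite !inE /P lambda_cons.
rewrite card_tupleS natrD gauss_binomS coefD coefMXn; congr (_ + _); last first.
  by rewrite -IHc; congr (_%:R); apply: eq_card => t; rewrite !inE /P lambda_cons.
(* A leading a has all [c - d] b's of [t] to its right, whence the factor ['X^(c - d)]; a leading b
   adds nothing. *)
have consP (t : c.-tuple bool) : P d.+1 k (true :: t)
    = [&& count_mem la t == d & (c - d + sumn (lambda t))%N == k].
  rewrite /P lambda_cons /= add1n eqSS.
  have := count_la_lb t; rewrite size_tuple.
  by case: eqP => // -> /(canRL (addKn _)) ->.
case: ltnP => le_k.
  by rewrite eq_card0 // => t; rewrite inE consP; apply/negP => /andP[_ /eqP]; lia.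
rewrite -IHc; congr (_%:R); apply: eq_card => t; rewrite !inE consP /P.
by congr (_ && _); lia.
Qed.

(* head la x = la says that x is empty or starts with an a.                    *)
Lemma cut_suffix l (w : seq bool) : (l <= count_mem la w)%N ->
  exists y x, [/\ w = y ++ x, count_mem la x = l & head la x = la].
Proof.
elim: w => [|x w IHw] /=; first by case: l => // _; exists [::], [::].
case: (leqP l (count_mem la w)) => [/IHw [y [x' [-> xl x'a]]] _ | lt_l le_l].
  by exists (x :: y), x'.
have xa : x = la by case: x le_l => //; rewrite add0n leqNgt lt_l.
exists [::], (x :: w); split=> //=.
by rewrite xa eqxx in le_l *; apply/eqP; rewrite eqn_leq le_l lt_l.
Qed.

Lemma tail_cat s y x : count_mem la x = ell s (y ++ x) ->
  tail s (y ++ x) = rev (lambda x).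
Proof.
by move=> xl; rewrite /tail -xl lambda_cat rev_cat take_size_cat // size_rev size_lambda.
Qed.

Lemma last_rev_lambda x : head la x = la ->
  last 0%N (rev (lambda x)) = count_mem lb x.
Proof.
by case: x => [|[] x] //= _; rewrite lambda_cons rev_cons last_rcons.
Qed.

Lemma theta_cat s y x : count_mem la x = ell s (y ++ x) -> head la x = la ->
  theta s (y ++ x) = count_mem lb x.
Proof. by move=> xl xa; rewrite /theta tail_cat // last_rev_lambda. Qed.

Lemma residual_area_cat s y x :
  count_mem la x = ell s (y ++ x) -> head la x = la ->
  residual_area s (y ++ x) = sumn (lambda y).
Proof.
move=> xl xa; rewrite /residual_area theta_cat // tail_cat // -xl.
rewrite scattered_ab sumn_lambda_cat sumn_rev count_cat addnK; lia.
Qed.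

Lemma tail_catP s u y x :
  count_mem la x = ell s (y ++ x) -> head la x = la ->
  size u = size (y ++ x) -> count_mem la u = count_mem la (y ++ x) ->
  (tail s u == tail s (y ++ x)) = (drop (size y) u == x).
Proof.
move=> xl xa szu ua.
have ellu : ell s u = ell s (y ++ x) by rewrite /ell ua.
apply/eqP/eqP => [|xE].
  (* Cut [u] in the same way. Equal tails give equal [lambda] of the suffixes, and their last
     entries give equal numbers of b's, so [lambda_inj] applies. *)
  have [|y' [x' [uE x'l x'a]]] := @cut_suffix (ell s u) u; first exact: geq_minr.
  rewrite uE in x'l *; rewrite !tail_cat // => /(congr1 rev); rewrite !revK => xx'.
  have x'x : x' = x.
    by apply: lambda_inj => //; rewrite -!last_rev_lambda // xx'.
  rewrite x'x drop_size_cat //.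
  by move: szu; rewrite uE x'x !size_cat => /addIn.
have uE : u = take (size y) u ++ x by rewrite -{1}(cat_take_drop (size y) u) xE.
by rewrite [in LHS]uE !tail_cat // -uE ellu.
Qed.

Theorem theorem3 (s n : nat) (w : n.-tuple bool) :
  #|approx_class s w|%:R
  = coefz (gauss_binom ((count_mem la w - ell s w)
                        + (count_mem lb w - theta s w))%N
                       (count_mem la w - ell s w)%N)
          (residual_area s w).
Proof.
have [|y [x [wE xl xa]]] := @cut_suffix (ell s w) w; first exact: geq_minr.
have szw : n = (size y + size x)%N by rewrite -size_cat -wE size_tuple.
have xl' := xl; rewrite wE in xl'.
have aE : (count_mem la w - ell s w)%N = count_mem la y.
  by rewrite -xl wE count_cat addnK.
have bE : (count_mem lb w - theta s w)%N = count_mem lb y.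
  by rewrite wE theta_cat // count_cat addnK.
(* The residual area is now a natural number, so [coefz] is an ordinary coefficient, and it counts
   words of length [size y]. *)
rewrite aE bE wE residual_area_cat //= count_la_lb -card_words.
rewrite -(card_tuple_suffix (fun t => (count_mem la t == count_mem la y)
  && (sumn (lambda t) == sumn (lambda y))) szw).
congr (_%:R); apply: eq_card => u; rewrite !inE /approx /sim2 !scattered_ab.
have dropP : count_mem la u = count_mem la w ->
    (tail s u == tail s w) = (drop (size y) u == x).
  by rewrite wE => ua; rewrite tail_catP // -wE !size_tuple.
have catP : drop (size y) u = x ->
    ((count_mem la u == count_mem la w)
     = (count_mem la (take (size y) u) == count_mem la y)).
  by move=> ux; rewrite -{1}(cat_take_drop (size y) u) ux wE !count_cat eqn_add2r.
(* With a common suffix [x] and equally many a's, the terms that [x] adds in [sumn_lambda_cat] agree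
   and cancel. *)
apply/idP/idP => [/andP[/andP[ua us]]|/andP[/eqP ux /andP[ua us]]].
  rewrite (dropP (eqP ua)) => /eqP ux; rewrite ux eqxx -(catP ux) ua /=.
  have /eqP ta := ua; rewrite catP // in ua.
  move: us; rewrite -{1}(cat_take_drop (size y) u) ux wE !sumn_lambda_cat.
  by rewrite (eqP ua) !eqn_add2r.
have ua' : count_mem la u = count_mem la w by apply/eqP; rewrite catP.
rewrite (dropP ua') ux eqxx ua' eqxx andbT /=.
rewrite -{1}(cat_take_drop (size y) u) ux wE !sumn_lambda_cat.
by rewrite (eqP ua) (eqP us).
Qed.
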